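(* Every left flotilla $H$ satisfies the Erdős–Hajnal Conjecture: there exists $\epsilon(H)>0$ such that every $H$-free tournament $T$ with $n$ vertices contains a transitive subtournament with at least $n^{\epsilon(H)}$ vertices.
   Context: A tournament is a digraph in which for every pair of distinct vertices $u,v$ exactly one of the arcs $(u,v),(v,u)$ is present; it is transitive if it has no directed cycle. $T$ contains $H$ if $H$ is isomorphic to an induced subtournament of $T$; otherwise $T$ is $H$-free. For an ordering $\theta=(v_1,\dots,v_n)$ of $V(T)$, an arc $(v_i,v_j)$ is backward if $i>j$, and $B(T,\theta)$ is the undirected graph on $V(T)$ whose edges are the pairs joined by a backward arc. A left boat in $B(T,\theta)$ is a set $\{v_{i_1},v_{i_2},v_{i_3},v_{i_4}\}$ with $i_1<i_2<i_3<i_4$ and $i_3=i_2+1=i_1+2$ such that the subgraph of $B(T,\theta)$ induced on it has exactly the edges $v_{i_1}v_{i_3}$, $v_{i_1}v_{i_4}$, $v_{i_2}v_{i_4}$. A tournament $H$ is a left flotilla if there exists an ordering $\theta$ of $V(H)$ such that every connected component of $B(H,\theta)$ is a left boat. *)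

(* Defs.v *)
From mathcomp Require Import all_boot.

Set Implicit Arguments.
Unset Strict Implicit.
Unset Printing Implicit Defensive.

Record tournament := Tournament {
  vertex :> finType;
  darc : rel vertex;
  darc_irr : irreflexive darc;
  darc_tot : forall u v : vertex, u != v -> darc u v (+) darc v u
}.

Definition induced_arc (T : tournament) (S : {set T}) :
    rel {x : T | x \in S} :=
  [rel x y | darc (val x) (val y)].

Lemma induced_arc_irr (T : tournament) (S : {set T}) :
  irreflexive (@induced_arc T S).
Proof. by move=> x; apply: darc_irr. Qed.

Lemma induced_arc_tot (T : tournament) (S : {set T})
    (x y : {x : T | x \in S}) :
  x != y -> induced_arc x y (+) induced_arc y x.
Proof. by move=> xy; apply: darc_tot; rewrite val_eqE. Qed.

Definition induced (T : tournament) (S : {set T}) : tournament :=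
  Tournament (@induced_arc_irr T S) (@induced_arc_tot T S).

(* [ucycle] also accepts the empty sequence, which is not a directed cycle. *)
Definition has_directed_cycle (T : tournament) : Prop :=
  exists c : seq T, c <> [::] /\ ucycle (@darc T) c.

Definition transitive_tournament (T : tournament) : Prop :=
  ~ has_directed_cycle T.

Definition isomorphic (H K : tournament) : Prop :=
  exists f : H -> K,
    bijective f /\ forall u v : H, darc (f u) (f v) = darc u v.

Definition contains (T H : tournament) : Prop :=
  exists S : {set T}, isomorphic H (induced S).

Definition H_free (H T : tournament) : Prop := ~ contains T H.

(* The entry of index [i] of [theta], counted from 0, is v_(i+1).  A
   duplicate-free tuple of length [#|T|] lists every vertex exactly once. *)
Definition ordering (T : tournament) (theta : #|T|.-tuple T) : Prop :=
  uniq theta.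

Definition backward_arc (T : tournament) (theta : #|T|.-tuple T) : rel T :=
  [rel u v | darc u v && (index v theta < index u theta)].

Definition backedge (T : tournament) (theta : #|T|.-tuple T) : rel T :=
  [rel u v | backward_arc theta u v || backward_arc theta v u].

Definition left_boat (T : tournament) (theta : #|T|.-tuple T)
    (X : {set T}) : Prop :=
  exists i1 i2 i3 i4 : 'I_#|T|,
    let v := tnth theta in
    let B := backedge theta in
    [/\ [/\ i1 < i2, i2 < i3 & i3 < i4],
        i3 = i2 + 1 :> nat /\ i3 = i1 + 2 :> nat,
        X = [set v i1; v i2; v i3; v i4],
        [/\ B (v i1) (v i3), B (v i1) (v i4) & B (v i2) (v i4)]
      & [/\ ~~ B (v i1) (v i2), ~~ B (v i2) (v i3) & ~~ B (v i3) (v i4)]].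

Definition left_flotilla (H : tournament) : Prop :=
  exists theta : #|H|.-tuple H,
    ordering theta /\
    forall x : H, left_boat theta [set y | connect (backedge theta) x y].

(* Main.v *)
Require Import Defs.
From mathcomp Require Import all_boot all_order all_algebra.
From mathcomp Require Import reals exp.
From mathcomp Require Import zify lra.
Import Order.TTheory GRing.Theory Num.Theory.

Set Implicit Arguments.
Unset Strict Implicit.
Unset Printing Implicit Defensive.

(** Let X be a smallest vertex set with tr X < |X|^eps, where tr is the largest
    size of a transitive subset. As T is H-free, X contains a sequence of
    sets of linear size, any two of which have almost all arcs going forward;
    H is embedded boat by boat, the first three vertices of a boat in one set
    A of the sequence and the last one in a later set D.

    Suppose that no boat can be found that way, and for d in D let N(d) be the
    out-neighbourhood of d in A. For every v in A outside N(d), all arcs then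
    go from the in-neighbours of v in N(d) to its out-neighbours in N(d), so the
    strong components of N(d) are modules of A; being strongly connected, these
    modules and the singletons are nested or disjoint, and the maximal ones, the
    blocks, partition A. Both a transitive set and N(d) meet a family of blocks V whose
    sum of tr V is at most tr X. A greedy choice of transitive sets of
    size close to tr X meeting no block too often then yields one of them, S,
    that misses N(d) for half of the vertices d of D. All arcs go from S to
    these d, and the transitive sets of both sides add up to more than tr X. *)

(** * Transitive subsets and modules *)

Section Tournaments.
Variable T : tournament.
Implicit Types (x y z u v d : T) (A B M S V X Y : {set T}).

Lemma darc_asym u v : darc u v -> darc v u = false.
Proof.
move=> uv; have nuv : u != v.
  by apply/eqP=> E; move: uv; rewrite E darc_irr.
by have := darc_tot nuv; rewrite uv /=; case: (darc v u).
Qed.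

Lemma darc_neq u v : darc u v -> u != v.
Proof. by apply: contraTneq => ->; rewrite darc_irr. Qed.

Lemma darcN u v : u != v -> darc u v = ~~ darc v u.
Proof. by move=> /darc_tot; case: (darc u v); case: (darc v u). Qed.

(** A tournament without cyclic triangles has no directed cycle, and triangles give a boolean test;
    [transitive_on_induced] returns to cycles. *)
Definition transitive_on S :=
  [forall x in S, forall y in S, forall z in S,
     (darc x y && darc y z) ==> ~~ darc z x].

Lemma transitive_onP S :
  reflect (forall x y z, x \in S -> y \in S -> z \in S ->
             darc x y -> darc y z -> darc z x -> False)
          (transitive_on S).
Proof.
apply: (iffP idP) => [tS x y z xS yS zS xy yz zx|noC].
  move/forall_inP: tS => /(_ x xS)/forall_inP/(_ y yS)/forall_inP/(_ z zS).
  by rewrite xy yz zx.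
apply/forall_inP=> x xS; apply/forall_inP=> y yS; apply/forall_inP=> z zS.
by apply/implyP=> /andP[xy yz]; apply/negP=> zx; apply: (noC x y z).
Qed.

Definition tr A := \max_(S : {set T} | (S \subset A) && transitive_on S) #|S|.

Lemma leq_tr A S : S \subset A -> transitive_on S -> #|S| <= tr A.
Proof. by move=> SA tS; apply: (@leq_bigmax_cond _ _ (fun S : {set T} => #|S|) S); rewrite SA tS. Qed.

Lemma tr_witness A :
  exists S, [/\ S \subset A, transitive_on S & #|S| = tr A].
Proof.
have [|S /andP[SA tS] eS] := @eq_bigmax_cond {set T}
  [pred S : {set T} | (S \subset A) && transitive_on S] (fun S => #|S|).
  apply/card_gt0P; exists set0; rewrite inE sub0set /=.
  by apply/transitive_onP=> x y z; rewrite inE.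
by exists S; split=> //; apply: esym eS.
Qed.

Lemma tr_mono A B : A \subset B -> tr A <= tr B.
Proof.
move=> AB; have [S [SA tS <-]] := tr_witness A.
by apply: leq_tr => //; apply: subset_trans AB.
Qed.

Lemma transitive_on_small S : #|S| <= 2 -> transitive_on S.
Proof.
move=> S2; apply/transitive_onP=> x y z xS yS zS xy yz zx.
suff : 3 <= #|S| by rewrite ltnNge S2.
apply/card_geqP; exists [:: x; y; z]; split=> //=.
  by rewrite !inE !negb_or (darc_neq xy) (darc_neq yz) eq_sym (darc_neq zx).
by move=> w; rewrite !inE => /or3P[] /eqP->.
Qed.

Lemma leq_card_tr A n : n <= 2 -> n <= #|A| -> n <= tr A.
Proof.
move=> n2 /card_geqP[s [us sn sA]]; rewrite -sn in n2 *.
rewrite -(card_uniqP us) -cardsE; apply: leq_tr.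
  by apply/subsetP=> x; rewrite inE; apply: sA.
by apply: transitive_on_small; rewrite cardsE (card_uniqP us).
Qed.

Lemma tr_join A B X : A \subset X -> B \subset X ->
  (forall a b, a \in A -> b \in B -> darc a b) -> tr A + tr B <= tr X.
Proof.
move=> AX BX AB.
have [S [SA tS <-]] := tr_witness A; have [S' [SB tS' <-]] := tr_witness B.
have dis : S :&: S' = set0.
  apply/setP=> x; rewrite !inE; apply/negP=> /andP[xS xS'].
  by have := AB x x (subsetP SA x xS) (subsetP SB x xS'); rewrite darc_irr.
have := cardsUI S S'; rewrite dis cards0 addn0 => <-.
apply: leq_tr.
  by rewrite subUset (subset_trans SA AX) (subset_trans SB BX).
have F a b : a \in S -> b \in S' -> darc b a = false.
  by move=> /(subsetP SA) aA /(subsetP SB) bB; apply: darc_asym; apply: AB.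
apply/transitive_onP=> x y z.
rewrite !inE => /orP[] xS /orP[] yS /orP[] zS xy yz zx;
  first [by move/transitive_onP: tS => /(_ x y z); apply
        |by move/transitive_onP: tS' => /(_ x y z); apply
        |by move: xy; rewrite F
        |by move: yz; rewrite F
        |by move: zx; rewrite F].
Qed.

(** A homogeneous set of the tournament on [A]. In a tournament, the arcs into [V] also settle the
    arcs out of [V]. *)
Definition module A V :=
  [forall v in A :\: V, forall x in V, forall y in V, darc v x == darc v y].

Lemma module_in A V v x y : module A V -> v \in A -> v \notin V ->
  x \in V -> y \in V -> darc v x = darc v y.
Proof.
move=> mV vA vV xV yV; move/forall_inP: mV => /(_ v).
by rewrite inE vV vA => /(_ isT)/forall_inP/(_ x xV)/forall_inP/(_ y yV)/eqP.
Qed.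

Lemma module_out A V v x y : module A V -> v \in A -> v \notin V ->
  x \in V -> y \in V -> darc x v = darc y v.
Proof.
move=> mV vA vV xV yV.
have nv w : w \in V -> w != v by apply: contraTneq => ->.
by rewrite !(@darcN _ v) ?nv // (module_in mV vA vV xV yV).
Qed.

Definition meets S V := S :&: V != set0.

Lemma meetsP S V : reflect (exists2 x, x \in S & x \in V) (meets S V).
Proof.
rewrite /meets; apply: (iffP (set0Pn _)) => [[x]|[x xS xV]].
  by rewrite inE => /andP[]; exists x.
by exists x; rewrite inE xS xV.
Qed.

(* Representatives of the modules met by X span a transitive tournament, so
   maximum transitive subsets of these modules have a transitive union. *)
Lemma sum_tr_modules A (P : {set {set T}}) X :
  trivIset P ->
  (forall V, V \in P -> V \subset A /\ module A V) ->
  (forall x y z Vx Vy Vz, x \in X -> y \in X -> z \in X ->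
     Vx \in P -> Vy \in P -> Vz \in P ->
     x \in Vx -> y \in Vy -> z \in Vz ->
     Vx != Vy -> Vy != Vz -> Vz != Vx ->
     darc x y -> darc y z -> darc z x -> False) ->
  \sum_(V in P | meets X V) tr V <= tr A.
Proof.
move=> tP PA noC.
have ex V : exists S, [&& S \subset V, transitive_on S & #|S| == tr V].
  by have [S [SV tS eS]] := tr_witness V; exists S; rewrite SV tS eS /=.
pose s V := xchoose (ex V).
have sP V : [/\ s V \subset V, transitive_on (s V) & #|s V| = tr V].
  by case/and3P: (xchooseP (ex V)) => ? ? /eqP.
pose Q := [set V in P | meets X V].
have QP V : V \in Q -> V \in P by rewrite inE => /andP[].
have dis V W x : V \in P -> W \in P -> x \in V -> x \in W -> V = W.
  by move=> VP WP xV xW; rewrite -(def_pblock tP VP xV) -(def_pblock tP WP xW).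
pose S := \bigcup_(V in Q) s V.
have SA : S \subset A.
  apply/bigcupsP=> V VQ; have [VA _] := PA V (QP V VQ).
  by apply: subset_trans VA; case: (sP V).
have -> : \sum_(V in P | meets X V) tr V = \sum_(V in Q) #|s V|.
  by rewrite big_set /=; apply: eq_bigr => V _; case: (sP V).
have leS : \sum_(V in Q) #|s V| <= #|S|.
  rewrite -[#|S|]sum1_card (partition_big (pblock P) (mem Q)) /=; last first.
    move=> x /bigcupP[V VQ xV]; have [sV _ _] := sP V.
    by rewrite (def_pblock tP (QP V VQ) (subsetP sV x xV)).
  apply: leq_sum => V VQ; rewrite sum1dep_card.
  apply/subset_leq_card/subsetP=> x xV; rewrite inE; have [sV _ _] := sP V.
  rewrite (def_pblock tP (QP V VQ) (subsetP sV x xV)) eqxx andbT.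
  by apply/bigcupP; exists V.
apply: (leq_trans leS); apply: leq_tr => //.
apply/transitive_onP=> x y z /bigcupP[Vx Qx xs] /bigcupP[Vy Qy ys].
move=> /bigcupP[Vz Qz zs] xy yz zx.
have inV V w : w \in s V -> w \in V by case: (sP V) => /subsetP h _ _; apply: h.
have out V W w : V \in Q -> W \in Q -> V != W -> w \in V -> w \notin W.
  move=> VQ WQ VW wV; apply: contraNN VW => wW; apply/eqP.
  by apply: (dis V W w); rewrite ?QP.
have inA V w : V \in Q -> w \in V -> w \in A.
  by move=> VQ; case: (PA V (QP V VQ)) => /subsetP h _; apply: h.
have mo V : V \in Q -> module A V by move=> VQ; case: (PA V (QP V VQ)).
(* A cyclic triangle cannot have exactly two vertices in a module. *)
have two u v w V W : V \in Q -> W \in Q -> u \in V -> v \in V -> w \in W ->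
    darc v w -> darc w u -> V = W.
  move=> VQ WQ uV vV wW vw wu; apply/eqP; apply: contraT => VW.
  have wV : w \notin V by apply: out wW; rewrite // eq_sym.
  move: wu; rewrite (module_in (mo V VQ) (inA _ _ WQ wW) wV uV vV).
  by rewrite (darc_asym vw).
have xV := inV _ _ xs; have yV := inV _ _ ys; have zV := inV _ _ zs.
have [Exy|Nxy] := eqVneq Vx Vy.
  have E : Vx = Vz by apply: (two x y z) => //; rewrite Exy.
  have [_ /transitive_onP tV _] := sP Vx.
  by apply: (tV x y z) => //; rewrite ?E // -E Exy.
have [Eyz|Nyz] := eqVneq Vy Vz.
  by case/eqP: Nxy; apply/esym; apply: (two y z x) => //; rewrite Eyz.
have [Ezx|Nzx] := eqVneq Vz Vx.
  by case/eqP: Nyz; apply/esym; apply: (two z x y) => //; rewrite Ezx.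
have rep V : V \in Q -> exists2 r, r \in X & r \in V.
  by rewrite inE => /andP[_ /meetsP].
(* All arcs between two distinct modules have the same direction, so the triangle can be moved to
   representatives in [X]. *)
have tran V W v w v' w' : V \in Q -> W \in Q -> V != W -> v \in V -> w \in W ->
    v' \in V -> w' \in W -> darc v w -> darc v' w'.
  move=> VQ WQ VW vV wW v'V w'W vw.
  rewrite -(module_out (mo V VQ) (inA _ _ WQ w'W) _ vV v'V); last first.
    by apply: out w'W; rewrite // eq_sym.
  by rewrite -(module_in (mo W WQ) (inA _ _ VQ vV) _ wW w'W) // (out V).
have [x' x'X x'V] := rep _ Qx; have [y' y'X y'V] := rep _ Qy.
have [z' z'X z'V] := rep _ Qz.
apply: (noC x' y' z' Vx Vy Vz) => //; first [exact: QP | idtac].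
- exact: (tran Vx Vy x y).
- exact: (tran Vy Vz y z).
- exact: (tran Vz Vx z x).
Qed.

End Tournaments.

(** * The blocks of a boat-free pair *)

Section Boatless.
Variables (T : tournament) (A D : {set T}).
Implicit Types (x y z u v d : T) (M S V X Y : {set T}).

Definition outset d := [set x in A | darc d x].

(** A left boat is a cyclic triangle v1, v2, v3 with a vertex v4 that dominates v1 and v2 and is
    dominated by v3; here [x], [y], [z], [d] play these parts. *)
Definition boat_free := forall d x y z, d \in D ->
  x \in A -> y \in A -> z \in A ->
  darc x y -> darc y z -> darc z x -> darc d x -> darc d y -> darc d z.

(** Strong connectivity through cuts instead of paths: the proofs below choose a cut and use an arc
    entering it. *)
Definition strong M := [forall P : {set T},
  [&& P \subset M, P != set0 & P != M] ==>
    [exists x in P, exists y in M :\: P, darc y x]].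

Lemma strongP M :
  reflect (forall P : {set T}, P \subset M -> P != set0 -> P != M ->
             exists x y, [/\ x \in P, y \in M, y \notin P & darc y x])
          (strong M).
Proof.
apply: (iffP forallP) => [sM P PM P0 PnM|sM P].
  have := sM P; rewrite PM P0 PnM => /existsP[x /andP[xP]].
  by case/existsP=> y /andP[]; rewrite inE => /andP[yP yM] yx; exists x, y.
apply/implyP=> /and3P[PM P0 PnM]; have [x [y [xP yM yP yx]]] := sM P PM P0 PnM.
by apply/existsP; exists x; rewrite xP; apply/existsP; exists y; rewrite inE yP yM.
Qed.

Lemma strong_set1 x : strong [set x].
Proof. by apply/strongP=> P; rewrite subset1 => /orP[]/eqP->; rewrite eqxx. Qed.

Lemma strong_setU1 M v a b : strong M -> a \in M -> b \in M ->
  darc v a -> darc b v -> strong (v |: M).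
Proof.
move=> /strongP sM aM bM va bv; apply/strongP=> P PM P0 PnM.
have [PM0|PM0] := eqVneq (P :&: M) set0.
  have Pv : P = [set v].
    apply/eqP; rewrite eqEsubset sub1set; apply/andP; split.
      apply/subsetP=> x xP; have := subsetP PM x xP; rewrite !inE.
      by case/orP=> // xM; move/setP: PM0 => /(_ x); rewrite !inE xP xM.
    case/set0Pn: P0 => x xP; have := subsetP PM x xP; rewrite !inE.
    case/orP=> [/eqP<- //|xM].
    by move/setP: PM0 => /(_ x); rewrite !inE xP xM.
  exists v, b; rewrite Pv !inE eqxx bM orbT bv (darc_neq bv).
  by split.
have [MP|nMP] := boolP (M \subset P).
  have vP : v \notin P.
    apply: contra PnM => vP; rewrite eqEsubset PM subUset MP sub1set vP //.
  exists a, v; rewrite !inE eqxx vP va (subsetP MP a aM); by split.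
have [x [y [xP yM yP yx]]] := sM (P :&: M) (subsetIr _ _) PM0
  (contraNN (fun E => introT setIidPr (eqP E)) nMP).
move: xP yP; rewrite !inE yM andbT => /andP[xP _] yP.
by exists x, y; rewrite !inE yM orbT.
Qed.

Lemma strong_triangle x y z :
  darc x y -> darc y z -> darc z x -> strong [set x; y; z].
Proof.
move=> xy yz zx; apply/strongP=> P PM P0 PnM.
(* Going backwards around the triangle from [b], the first vertex outside [P] starts an arc that
   enters [P]. *)
have key a b c : darc a b -> darc b c -> darc c a -> [set x; y; z] = [set a; b; c]
    -> b \in P -> 
    exists u v, [/\ u \in P, v \in [set x; y; z], v \notin P & darc v u].
  move=> ab bc ca E bP; rewrite E in PM PnM *.
  have [aP|aP] := boolP (a \in P); last first.
    by exists b, a; rewrite !inE eqxx.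
  have [cP|cP] := boolP (c \in P); last first.
    by exists a, c; rewrite !inE eqxx orbT.
  case/eqP: PnM; apply/eqP; rewrite eqEsubset PM /=.
  by apply/subsetP=> w; rewrite !inE => /orP[/orP[]|] /eqP->.
case/set0Pn: P0 => b bP; have := subsetP PM b bP; rewrite !inE.
have rot u v w : [set u; v; w] = [set v; w; u].
  by apply/setP=> t; rewrite !inE; do ![case: (_ == _)].
case/orP=> [/orP[]|] /eqP Eb; rewrite Eb in bP.
- by apply: (key z x y); rewrite // rot rot.
- exact: (key x y z).
- by apply: (key y z x); rewrite // rot.
Qed.

Definition strong_modules := [set M : {set T} |
  [&& M \subset A, M != set0, module A M, strong M &
      (#|M| == 1) || [exists d in D, M \subset outset d]]].

(** Otherwise some [w] in [M'] outside [M] dominates all of [M] or is dominated by all of [M]. As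
    [M] is strong, an arc enters [M :&: M'], respectively [M :\: M'], from the rest of [M]; compared
    with the arcs at [w], it contradicts that [M'] is a module. *)
Lemma strong_modules_nested M M' x :
  M \in strong_modules -> M' \in strong_modules ->
  x \in M -> x \in M' -> (M \subset M') || (M' \subset M).
Proof.
rewrite !inE => /and5P[MA _ mM /strongP sM _] /and5P[MA' _ mM' _ _] xM xM'.
apply: contraT; rewrite negb_or => /andP[/subsetPn[u uM uM'] /subsetPn[w wM' wM]].
have uA := subsetP MA u uM; have wA := subsetP MA' w wM'.
have wx : w != x by apply: contraNneq wM => ->.
have [cwx|] := boolP (darc w x).
  have [||a [b [aP bM bP ba]]] := sM (M :&: M') (subsetIl _ _).
  - by apply/set0Pn; exists x; rewrite inE xM.
  - by apply: contraNneq uM' => E; move: uM; rewrite -E inE => /andP[].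
  move: aP bP; rewrite !inE bM => /andP[aM aM'] /= bM'.
  have wb : darc w b by rewrite (module_in mM wA wM bM xM).
  move: ba; rewrite (module_in mM' (subsetP MA b bM) bM' aM' wM').
  by rewrite (darc_asym wb).
rewrite -darcN 1?eq_sym // => xw.
have [||a [b [aP bM bP ba]]] := sM (M :\: M') (subsetDl _ _).
- by apply/set0Pn; exists u; rewrite inE uM uM'.
- by apply/eqP=> E; move: xM; rewrite -E inE xM'.
move: aP bP; rewrite !inE bM andbT negbK => /andP[aM' aM] bM'.
have aw : darc a w by rewrite (module_out mM wA wM aM xM).
move: ba; rewrite (module_out mM' (subsetP MA a aM) aM' bM' wM').
by rewrite (darc_asym aw).
Qed.

Hypothesis noboat : boat_free.

(** A maximal strong subset of the out-neighbourhood of [d] containing the triangle works: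
    maximality handles the vertices [v] inside the out-neighbourhood, the absence of boats those
    outside. *)
Lemma triangle_in_strong_module d x y z : d \in D ->
  x \in outset d -> y \in outset d -> z \in outset d ->
  darc x y -> darc y z -> darc z x ->
  exists2 M, M \in strong_modules & [/\ x \in M, y \in M & z \in M].
Proof.
move=> dD xd yd zd xy yz zx.
pose p M := strong M && (M \subset outset d).
have [|M /maxsetP[/andP[sM Md] maxM] tM] := @maxset_exists _ p [set x; y; z].
  rewrite /p strong_triangle //=; apply/subsetP=> w; rewrite !inE.
  by case/orP=> [/orP[]|] /eqP->; rewrite -in_set; move: xd yd zd; rewrite !inE.
have [xM yM zM] : [/\ x \in M, y \in M & z \in M].
  by split; apply: (subsetP tM); rewrite !inE eqxx ?orbT.
exists M => //.
have MA : M \subset A.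
  by apply: subset_trans Md _; apply/subsetP=> w; rewrite inE => /andP[].
rewrite inE MA sM /=; apply/and3P; split; last 1 first.
- by apply/orP; right; apply/existsP; exists d; rewrite dD.
- by apply/set0Pn; exists x.
have mixed v a b : v \in A -> v \notin M -> a \in M -> b \in M ->
    darc v a -> darc b v -> False.
  move=> vA vM aM bM va bv.
  have [vd|vd] := boolP (v \in outset d).
    suff E : v |: M = M by move/negP: vM; apply; rewrite -E !inE eqxx.
    apply: maxM; last exact: subsetUr.
    by rewrite /p (strong_setU1 sM aM bM va bv) /= subUset sub1set vd.
  (* An arc from an out-neighbour to an in-neighbour of [v] would close a cyclic triangle forming a
     boat with [d]. Yet such an arc must enter the set of in-neighbours of [v], as [M] is strong. *)
  have cut a' b' : a' \in M -> b' \in M -> darc v a' -> darc b' v ->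
      darc a' b' -> False.
    move=> aM' bM' va' bv' ab; move/negP: vd; apply; rewrite inE vA /=.
    have := subsetP Md a' aM'; have := subsetP Md b' bM'.
    rewrite !inE => /andP[bA db] /andP[aA da].
    exact: (noboat dD aA bA vA ab bv' va' da db).
  move/strongP: (sM) => /(_ [set w in M | darc w v]).
  case=> [|||s [t [sP tinM tP ts]]].
  - by apply/subsetP=> w; rewrite inE => /andP[].
  - by apply/set0Pn; exists b; rewrite inE bM.
  - by apply/eqP=> E; move: aM; rewrite -E inE (darc_asym va) andbF.
  move: sP tP; rewrite !inE tinM /= => /andP[sM' sv] tv.
  apply: (cut t s) => //; rewrite darcN //.
  by apply: contraNneq vM => ->.
apply/forall_inP=> v; rewrite inE => /andP[vM vA].
apply/forall_inP=> a aM; apply/forall_inP=> b bM.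
have nv w : w \in M -> v != w by move=> wM; apply: contraNneq vM => ->.
case va : (darc v a); case vb : (darc v b) => //.
  by case: (mixed v a b) => //; rewrite darcN 1?eq_sym ?nv // vb.
by case: (mixed v b a) => //; rewrite darcN 1?eq_sym ?nv // va.
Qed.

Definition blocks :=
  [set M in strong_modules |
     [forall M' in strong_modules, (M \subset M') ==> (M' == M)]].

Lemma blocksP V : reflect (V \in strong_modules /\
    forall W, W \in strong_modules -> V \subset W -> W = V) (V \in blocks).
Proof.
rewrite [V \in blocks]in_set; apply: (iffP andP) => [[Vm maxV]|[Vm maxV]].
  split=> // W Wm VW; move/forall_inP: maxV => /(_ W Wm).
  by rewrite VW => /eqP.
by split=> //; apply/forall_inP=> W Wm; apply/implyP=> VW; apply/eqP/maxV.
Qed.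

Lemma sub_block M : M \in strong_modules ->
  exists2 V, V \in blocks & M \subset V.
Proof.
move=> Mm; have [V /maxsetP[Vm maxV] MV] :=
  @maxset_exists _ [in strong_modules] M Mm.
by exists V => //; apply/blocksP; split.
Qed.

Lemma blocks_eq V W x : V \in blocks -> W \in blocks -> x \in V -> x \in W ->
  V = W.
Proof.
move=> /blocksP[Vm maxV] /blocksP[Wm maxW] xV xW.
by case/orP: (strong_modules_nested Vm Wm xV xW) => [/maxV->|/maxW->].
Qed.

Lemma trivIset_blocks : trivIset blocks.
Proof.
apply/trivIsetP=> V W Vb Wb; apply: contraNT => /pred0Pn[x /andP[xV xW]].
exact/eqP/(blocks_eq Vb Wb xV xW).
Qed.

Lemma block_module V : V \in blocks ->
  [/\ V \subset A, module A V & V != set0].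
Proof. by case/blocksP; rewrite inE => /and5P[]. Qed.

Lemma cover_blocks : cover blocks = A.
Proof.
apply/eqP; rewrite eqEsubset; apply/andP; split.
  by apply/bigcupsP=> V /block_module[].
apply/subsetP=> x xA; have [|V Vb xV] := @sub_block [set x].
  rewrite inE sub1set xA strong_set1 cards1 eqxx /= !andbT.
  apply/andP; split; first by apply/set0Pn; exists x; rewrite set11.
  apply/forall_inP=> v _; apply/forall_inP=> a; rewrite inE => /eqP->.
  by apply/forall_inP=> b; rewrite inE => /eqP->.
by apply/bigcupP; exists V => //; rewrite -sub1set.
Qed.

Lemma blocks_small k V : (forall d, d \in D -> k * #|outset d| <= #|A|) ->
  k <= #|A| -> V \in blocks -> k * #|V| <= #|A|.
Proof.
move=> kd kA /blocksP[+ _]; rewrite inE => /and5P[_ _ _ _ /orP[/eqP->|]].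
  by rewrite muln1.
case/existsP=> d /andP[dD /subset_leq_card Vd].
by apply: leq_trans (kd d dD); rewrite leq_mul2l Vd orbT.
Qed.

(** A cyclic triangle inside an out-neighbourhood lies in one strong module, hence in one block, so
    its vertices cannot represent distinct blocks. *)
Lemma sum_tr_blocks X : X \subset A ->
  transitive_on X || [exists d in D, X == outset d] ->
  \sum_(V in blocks | meets X V) tr V <= tr A.
Proof.
move=> XA hX; apply: sum_tr_modules; first exact: trivIset_blocks.
  by move=> V /block_module[].
move=> x y z Vx Vy Vz xX yX zX Vxb Vyb Vzb xV yV zV VxVy _ _ xy yz zx.
case/orP: hX => [/transitive_onP tX|/existsP[d /andP[dD /eqP Ed]]].
  exact: (tX x y z).
rewrite Ed in xX yX zX.
have [M Mm [xM yM _]] := triangle_in_strong_module dD xX yX zX xy yz zx.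
have [W Wb MW] := sub_block Mm.
move/eqP: VxVy; apply; rewrite (blocks_eq Vxb Wb xV (subsetP MW x xM)).
by rewrite (blocks_eq Vyb Wb yV (subsetP MW y yM)).
Qed.

(* Greedy choice: a block met by already 2 tr V of the sets is exhausted, and
   double counting the incidences with exhausted blocks shows that they cover
   at most half of A. *)
Lemma spread_transitive_sets t k : tr A <= t ->
  (forall B : {set T}, B \subset A -> #|A| <= 2 * #|B| -> 3 * t <= 4 * tr B) ->
  (forall V, V \in blocks -> 4 * t ^ 2 * #|V| <= #|A| * tr V ^ 2) ->
  k <= 4 * t ->
  exists s : seq {set T},
    [/\ size s = k,
        forall S : {set T}, S \in s -> [/\ S \subset A, transitive_on S & 3 * t <= 4 * #|S|]
      & forall V, V \in blocks -> count (fun S => meets S V) s <= 2 * tr V].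
Proof.
move=> At C1 C2; elim: k => [|k IH] kt; first by exists [::]; split.
have [s [sk sS sV]] := IH (ltnW kt).
pose E := [set V in blocks | 2 * tr V <= count (fun S => meets S V) s].
have Eb V : V \in E -> V \in blocks by rewrite [V \in E]in_set => /andP[].
have EA : cover E \subset A.
  by apply/bigcupsP=> V /Eb /block_module[].
have cE : #|cover E| = \sum_(V in E) #|V|.
  have [_ /esym] := leq_card_cover E.
  rewrite (trivIsetS _ trivIset_blocks); last by apply/subsetP=> V /Eb.
  by move/esym/eqP.
(* Each set of [s] contributes the sum of [tr V] over the blocks that it meets, at most [t], and [s]
   has at most [4 * t] sets. *)
have count_le : \sum_(V in blocks) tr V * count (fun S => meets S V) s <= 4 * t ^ 2.
  under eq_bigr => V _ do rewrite -sum1_count big_distrr /= big_mkcond /=.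
  rewrite exchange_big /=.
  apply: (@leq_trans (\sum_(S <- s) t)); last first.
    rewrite big_const_seq count_predT iter_addn_0 sk mulnC expnS expn1 mulnA.
    by rewrite leq_mul2r (ltnW kt) orbT.
  rewrite big_seq [leqRHS]big_seq; apply: leq_sum => S Ss.
  have [SA tS _] := sS S Ss; apply: leq_trans At.
  rewrite -big_mkcondr /=; under eq_bigr => V _ do rewrite muln1.
  by apply: sum_tr_blocks; rewrite ?tS.
have Esq : 2 * \sum_(V in E) tr V ^ 2 <= 4 * t ^ 2.
  apply: leq_trans count_le; rewrite big_distrr /=.
  apply: (@leq_trans (\sum_(V in E) tr V * count (fun S => meets S V) s)).
    apply: leq_sum => V; rewrite in_set => /andP[_ h].
    by rewrite expnS expn1 mulnCA leq_mul2l h orbT.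
  rewrite [leqRHS](big_setID E) /=.
  have -> : blocks :&: E = E by apply/setIidPr/subsetP=> V /Eb.
  exact: leq_addr.
have Ebnd : 4 * t ^ 2 * #|cover E| <= #|A| * \sum_(V in E) tr V ^ 2.
  rewrite cE !big_distrr /=; apply: leq_sum => V /Eb; exact: C2.
have half : #|A| <= 2 * #|A :\: cover E|.
  have cA : #|A :\: cover E| = #|A| - #|cover E|.
    by rewrite cardsD (setIidPr EA).
  have := subset_leq_card EA.
  have : 0 < t by lia.
  move: Ebnd Esq cA; set a := #|A|; set c := #|cover E|; set w := \sum_(V in E) _.
  set b := #|_ :\: _|; move=> h1 h2 -> t0 ca.
  have t2 : 0 < t ^ 2 by rewrite expn_gt0 t0.
  suff : 2 * c <= a by lia.
  nia.
have [S [SA tS eS]] := tr_witness (A :\: cover E).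
exists (S :: s); split; first by rewrite /= sk.
  move=> S'; rewrite inE => /orP[/eqP->|/sS//]; split=> //.
    by apply: subset_trans SA (subsetDl _ _).
  by rewrite eS; apply: C1 => //; apply: subsetDl.
(* The new set avoids [cover E], so any block that it meets was still below its limit. *)
move=> V Vb /=; have [m|_] := boolP (meets S V); last by rewrite add0n sV.
rewrite add1n ltnNge; apply/negP=> h.
have VE : V \in E by rewrite in_set Vb.
case/meetsP: m => x /(subsetP SA); rewrite inE => /andP[/negP nx _] xV.
by apply: nx; apply/bigcupP; exists V.
Qed.

(** Of [4 * t] spread sets, at most [2 * t] meet a given out-neighbourhood, so on average one of
    them is missed by half of [D]. It and a transitive subset of that half each have at least three
    quarters of [t] vertices, and their union is transitive. *)
Lemma boat_free_false t : 0 < t -> tr A <= t ->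
  [disjoint A & D] ->
  (forall d, d \in D -> 65 * #|outset d| <= #|A|) -> 65 <= #|A| ->
  (forall B : {set T}, B \subset A -> #|A| <= 2 * #|B| -> 3 * t <= 4 * tr B) ->
  (forall B : {set T}, B \subset D -> #|D| <= 2 * #|B| -> 3 * t <= 4 * tr B) ->
  (forall V : {set T}, V \subset A -> V != set0 -> 65 * #|V| <= #|A| ->
     4 * t ^ 2 * #|V| <= #|A| * tr V ^ 2) ->
  tr (A :|: D) <= t -> False.
Proof.
move=> t0 At dis dsmall A65 CA CD CV ADt.
have [|s [sk sS sV]] := spread_transitive_sets At CA _ (leqnn (4 * t)).
  move=> V Vb; have [VA _ V0] := block_module Vb.
  by apply: CV => //; apply: blocks_small.
(* A set meeting the out-neighbourhood meets one of the blocks that the out-neighbourhood meets, and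
   each block is met by at most [2 * tr V] sets. *)
have hit d : d \in D -> count (fun S => meets S (outset d)) s <= 2 * t.
  move=> dD.
  have tot : \sum_(V in blocks | meets (outset d) V) tr V <= t.
    apply: leq_trans At; apply: sum_tr_blocks.
      by apply/subsetP=> x; rewrite inE => /andP[].
    by apply/orP; right; apply/existsP; exists d; rewrite dD eqxx.
  apply: (@leq_trans (\sum_(V in blocks | meets (outset d) V) 2 * tr V)); last first.
    by rewrite -big_distrr /= leq_mul2l tot.
  apply: (@leq_trans (\sum_(V in blocks | meets (outset d) V)
     count (fun S => meets S V) s)); last by apply: leq_sum => V /andP[/sV].
  under eq_bigr => V _ do rewrite -sum1_count big_mkcond /=.
  rewrite exchange_big /= -sum1_count big_mkcond /=; apply: leq_sum => S _.
  case: ifP => // /meetsP[x xS]; rewrite inE => /andP[xA dx].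
  move: (xA); rewrite -cover_blocks => /bigcupP[V Vb xV].
  rewrite (bigD1 V) /=; last first.
    by rewrite Vb; apply/meetsP; exists x; rewrite // inE xA.
  by rewrite ifT //; apply/meetsP; exists x.
have [S Ss SD] : exists2 S, S \in s &
    #|D| <= 2 * #|[set d in D | ~~ meets S (outset d)]|.
  apply/hasP; apply: contraT => /hasPn no.
  have h1 : \sum_(S <- s) #|[set d in D | meets S (outset d)]| <= #|D| * (2 * t).
    under eq_bigr => S _ do rewrite -sum1dep_card big_mkcondr.
    rewrite exchange_big /= -sum_nat_const; apply: leq_sum => d dD.
    by rewrite -big_mkcond sum1_count hit.
  (* The successor keeps the strict inequality, without which [h1] would not be contradicted. *)
  have h2 : \sum_(S <- s) (#|D|).+1 <= 2 * \sum_(S <- s) #|[set d in D | meets S (outset d)]|.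
    rewrite big_distrr /= big_seq [leqRHS]big_seq; apply: leq_sum => S /no.
    have -> : [set d in D | ~~ meets S (outset d)] =
        D :\: [set d in D | meets S (outset d)].
      by apply/setP=> d; rewrite !inE; case: (d \in D); rewrite //= ?andbT ?andbF.
    rewrite cardsD (setIidPr _); last by apply/subsetP=> d; rewrite inE => /andP[].
    set c := #|[set d in D | meets _ _]|; lia.
  move: h2; rewrite big_const_seq count_predT iter_addn_0 sk; nia.
have [SA tS eS] := sS S Ss.
pose D' := [set d in D | ~~ meets S (outset d)].
have D'D : D' \subset D by apply/subsetP=> d; rewrite inE => /andP[].
have := tr_join (subset_trans SA (subsetUl A D)) (subset_trans D'D (subsetUr A D)).
have := leq_tr (subxx S) tS.
have := CD D' D'D SD.
move=> h1 h2 h3.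
suff : tr S + tr D' <= t by lia.
apply: leq_trans ADt; apply: h3 => a d aS; rewrite inE => /andP[dD nm].
have aA := subsetP SA a aS.
rewrite darcN.
  apply: contra nm => da; apply/meetsP; exists a; rewrite // inE aA //.
by apply: contraTneq aA => ->; rewrite (disjointFl dis dD).
Qed.

End Boatless.

(** * Sequences of sets with almost all arcs forward *)

Definition embeds (H T : tournament) (X : {set T}) :=
  exists f : H -> T, (forall u, f u \in X) /\
    forall u v, darc u v -> darc (f u) (f v).

(** Exactly one arc joins two distinct vertices, so a map preserving arcs is automatically injective
    and reflects them. *)
Lemma embeds_contains (H T : tournament) (X : {set T}) :
  embeds H X -> contains T H.
Proof.
move=> [f [_ fhom]].
have finj : injective f.
  move=> u v E; apply/eqP; apply: contraT => /darc_tot.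
  case uv : (darc u v); first by move: (fhom _ _ uv); rewrite E darc_irr.
  by move=> /fhom; rewrite E darc_irr.
have fS u : f u \in f @: [set: H] by apply: imset_f.
exists (f @: [set: H]), (fun u => exist _ (f u) (fS u)); split.
  apply: inj_card_bij => [u v [/finj]//|].
  by rewrite card_sig card_imset // cardsT.
move=> u v; rewrite /= /induced_arc /=.
case uv : (darc u v); first exact: fhom.
have [->|nuv] := eqVneq u v; first exact: darc_irr.
by apply: darc_asym; apply: fhom; rewrite darcN 1?eq_sym // uv.
Qed.

Lemma exists_subset_card (T : finType) (A : {set T}) m : m <= #|A| ->
  exists2 B : {set T}, B \subset A & #|B| = m.
Proof.
move=> /card_geqP[s [us sm sA]]; exists [set x in s].
  by apply/subsetP=> x; rewrite inE; apply: sA.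
by rewrite cardsE (card_uniqP us).
Qed.

Definition sparse (T : finType) (r : rel T) K (A B : {set T}) :=
  (forall a, a \in A -> K * #|[set b in B | r a b]| <= #|B|) /\
  (forall b, b \in B -> K * #|[set a in A | r a b]| <= #|A|).

Section Sparse.
Variable T : finType.
Implicit Types (A B : {set T}).

(** Cutting [A] down to [m] vertices and removing these from [B] costs at most half of [B]; by
    double counting, at most half of the rest has too many neighbours in the new [A]. The factor 4
    pays for both halvings. *)
Lemma sparse_of_one_sided (r : rel T) K m A B :
  0 < m -> m <= #|A| -> 2 * m <= #|B| ->
  (forall a, a \in A -> 4 * K * #|[set b in B | r a b]| <= #|B|) ->
  exists A' B', [/\ A' \subset A /\ B' \subset B, [disjoint A' & B'],
     m <= #|A'| , m <= 2 * #|B'| & sparse r K A' B'].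
Proof.
move=> m0 mA mB rAB; have [A1 A1A cA1] := exists_subset_card mA.
pose B1 := B :\: A1.
have cB1 : #|B| <= 2 * #|B1|.
  have := cardsID A1 B; have := subset_leq_card (subsetIr B A1); rewrite /B1; lia.
have B1B : B1 \subset B by apply: subsetDl.
have r1 a : a \in A1 -> 2 * K * #|[set b in B1 | r a b]| <= #|B1|.
  move=> /(subsetP A1A) /rAB.
  have : #|[set b in B1 | r a b]| <= #|[set b in B | r a b]|.
    apply/subset_leq_card/subsetP=> b; rewrite !inE.
    by case/andP=> /andP[_ ->] ->.
  by move: cB1; nia.
pose bad := [set b in B1 | #|A1| < K * #|[set a in A1 | r a b]|].
have badB : bad \subset B1 by apply/subsetP=> b; rewrite inE => /andP[].
have cbad : 2 * #|bad| <= #|B1|.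
  have dc : \sum_(b in bad) #|[set a in A1 | r a b]| <=
            \sum_(a in A1) #|[set b in B1 | r a b]|.
    under eq_bigr => b _ do rewrite -sum1dep_card big_mkcondr.
    rewrite exchange_big /=; apply: leq_sum => a _.
    rewrite -big_mkcondr sum1dep_card; apply/subset_leq_card/subsetP=> b.
    by rewrite !inE => /andP[/andP[-> _] ->].
  have l1 : #|bad| * #|A1| <= K * \sum_(b in bad) #|[set a in A1 | r a b]|.
    rewrite -sum_nat_const big_distrr; apply: leq_sum => b.
    by rewrite inE => /andP[_ /ltnW].
  have l2 : 2 * K * \sum_(a in A1) #|[set b in B1 | r a b]| <= #|A1| * #|B1|.
    by rewrite -sum_nat_const big_distrr; apply: leq_sum => a /r1.
  have A10 : 0 < #|A1| by rewrite cA1.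
  by rewrite -(leq_pmul2r A10); move: dc l1 l2; nia.
have cB2 : #|B1| <= 2 * #|B1 :\: bad| by rewrite cardsD (setIidPr badB); lia.
exists A1, (B1 :\: bad); split=> //.
- by split=> //; apply: subset_trans (subsetDl _ _) B1B.
- rewrite disjoint_sym; apply/pred0Pn=> -[x /andP[]].
  by rewrite /= !inE => /andP[_ /andP[/negP]].
- by rewrite cA1.
- by move: cB1 cB2; lia.
split=> [a aA|b].
  have := r1 a aA.
  have : #|[set b in B1 :\: bad | r a b]| <= #|[set b in B1 | r a b]|.
    apply/subset_leq_card/subsetP=> b; rewrite !inE.
    by case/andP=> /andP[_ ->] ->.
  by move: cB2; nia.
by rewrite inE => /andP[]; rewrite inE => /[swap] -> /=; rewrite -leqNgt.
Qed.
End Sparse.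

(* Vertices are embedded one at a time; if no choice for the next vertex keeps
   a K-th of every remaining candidate set, then by pigeonhole many of its
   candidates are sparse towards the same remaining set. *)
Lemma embed_or_sparse (H T : tournament) (X : {set T}) M K h (t0 : T)
    (s : seq H) (V : H -> {set T}) :
  0 < M -> 0 < K -> uniq s -> size s <= h ->
  (forall u, u \in s -> V u \subset X /\ h * M * K ^ size s <= #|V u|) ->
  (exists f : H -> T, (forall u, u \in s -> f u \in V u) /\
     forall u v, u \in s -> v \in s -> darc u v -> darc (f u) (f v)) \/
  (exists A B : {set T}, [/\ A \subset X, B \subset X, M <= #|A|, M <= #|B| &
     (forall a, a \in A -> K * #|[set b in B | darc a b]| <= #|B|) \/
     (forall a, a \in A -> K * #|[set b in B | darc b a]| <= #|B|)]).
Proof.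
move=> M0 K0; elim: s V => [|w s IH] V; first by left; exists (fun=> t0).
rewrite cons_uniq => /andP[ws us] sh VP.
pose G v u := [set y in V u | if darc w u then darc v y else darc y v].
have GV v u : G v u \subset V u by apply/subsetP=> y; rewrite inE => /andP[].
have [wX wc] := VP w (mem_head _ _).
have sV u : u \in s -> u \in w :: s by rewrite inE orbC => ->.
have [/existsP[v /andP[vV /allP good]]|] := boolP
    [exists v in V w, all (fun u => #|V u| <= K * #|G v u|) s].
  have [||[f [fV fhom]]|] := IH (G v) us; [exact: ltnW| | |by right].
    move=> u us'; have [uX uc] := VP u (sV u us'); split.
      exact: subset_trans (GV v u) uX.
    rewrite -(leq_pmul2r K0) -mulnA -expnSr [leqRHS]mulnC.
    exact: leq_trans uc (good u us').
  have fG u : u \in s -> (f u \in V u) /\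
      (if darc w u then darc v (f u) else darc (f u) v).
    by move=> /fV; rewrite inE => /andP[].
  left; exists (fun u => if u == w then v else f u); split.
    move=> u; rewrite inE; case: eqP => [->//|_ /=] us'.
    by have [] := fG u us'.
  move=> u u'; rewrite !inE; case: eqP => [->|_]; case: eqP => [->|_] //=.
  - by rewrite darc_irr.
  - by move=> _ /fG[_] + wu; rewrite wu.
  - by move=> /fG[_] + _ uw; rewrite (darc_asym uw).
  - exact: fhom.
rewrite negb_exists => /forallP bad; right.
(* The choices for [w] that shrink the candidates of [u] too much. If every [C u] had fewer than [M]
   elements, their union would be too small to cover [V w]. *)
pose C u := [set v in V w | K * #|G v u| < #|V u|].
have VC : V w \subset \bigcup_(u in s) C u.
  apply/subsetP=> v vV; have := bad v; rewrite vV /= => /allPn[u us'].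
  rewrite -ltnNge => lt; apply/bigcupP; exists u => //.
  by rewrite inE vV.
have [/hasP[u us' Mu]|] := boolP (has (fun u => M <= #|C u|) s).
  have [uX uc] := VP u (sV u us').
  exists (C u), (V u); split=> //.
  - by apply: subset_trans wX; apply/subsetP=> y; rewrite inE => /andP[].
  - apply: leq_trans uc.
    by rewrite mulnAC leq_pmull // muln_gt0 expn_gt0 K0 (leq_trans _ sh).
  - case wu : (darc w u); [left|right] => a; rewrite inE /G wu => /andP[_];
      exact: ltnW.
rewrite -all_predC => /allP small.
have : #|V w| < h * M.
  apply: leq_ltn_trans (subset_leq_card VC) _.
  rewrite -bigcup_seq.
  apply: (@leq_ltn_trans (size s * M)); last by rewrite ltn_pmul2r.
  elim: (s) small => [|u s' IHs] small; first by rewrite big_nil cards0.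
  rewrite big_cons; apply: leq_trans (leq_card_setU _ _) _ => /=.
  rewrite mulSn leq_add //.
    by rewrite ltnW // ltnNge; apply: (small u); rewrite mem_head.
  by apply: IHs => u' us'; apply: small; rewrite inE us' orbT.
have : 0 < K ^ size (w :: s) by rewrite expn_gt0 K0.
by move: wc; nia.
Qed.

Definition forward (T : tournament) K (A B : {set T}) :=
  sparse (fun a b => ~~ darc a b) K A B.

Lemma sparse_forward (T : tournament) K (A B : {set T}) : [disjoint A & B] ->
  sparse (fun a b => darc b a) K A B -> forward K A B.
Proof.
move=> dis [hA hB].
have E a b : a \in A -> b \in B -> ~~ darc a b = darc b a.
  by move=> aA bB; rewrite -darcN //; apply: contraTneq bB => ->; rewrite (disjointFr dis aA).
split=> [a aA|b bB].
  have -> : [set b in B | ~~ darc a b] = [set b in B | darc b a].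
    by apply/setP=> b; rewrite !inE; apply: andb_id2l => bB; apply: E.
  exact: hA.
have -> : [set a in A | ~~ darc a b] = [set a in A | darc b a].
  by apply/setP=> a; rewrite !inE; apply: andb_id2l => aA; apply: E.
exact: hB.
Qed.

Lemma forward_pair (H : tournament) K : 0 < K ->
  exists N, forall (T : tournament) (X : {set T}), N <= #|X| ->
  embeds H X \/ exists A B : {set T}, [/\ A \subset X /\ B \subset X, [disjoint A & B],
    #|X| <= N * #|A|, #|X| <= N * #|B| & forward K A B].
Proof.
(* With this [c], [m * c <= #|X|] is the size condition of [embed_or_sparse] for [2 * m] and
   [4 * K], the values needed by [sparse_of_one_sided]. In [4 * c], one factor 2 pays for rounding
   [m], the other for [m <= 2 * #|B'|]. *)
move=> K0; pose h := #|H|.+1; pose c := 2 * h * (4 * K) ^ #|H|.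
have c0 : 0 < c by rewrite /c !muln_gt0 expn_gt0 muln_gt0 K0.
exists (4 * c) => T X XN.
have [x0 x0X] : exists x, x \in X by apply/card_gt0P; lia.
pose m := #|X| %/ c.
have m0 : 0 < m by rewrite divn_gt0 //; lia.
have Xm : #|X| <= 2 * c * m by have := ltn_ceil #|X| c0; rewrite -/m; nia.
have [|||||[f [fV fhom]]|] := @embed_or_sparse H T X (2 * m) (4 * K) h x0
    (enum H) (fun=> X).
- by rewrite muln_gt0.
- by rewrite muln_gt0 K0.
- exact: enum_uniq.
- by rewrite -cardE.
- move=> u _; split=> //; rewrite -cardE.
  have -> : h * (2 * m) * (4 * K) ^ #|H| = m * c by rewrite /c; lia.
  exact: leq_trunc_div.
- left; exists f; split=> [u|u v]; first by apply: fV; rewrite mem_enum.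
  by apply: fhom; rewrite mem_enum.
move=> [A [B [AX BX mA mB AB]]]; right.
have sub (A' B' : {set T}) : A' \subset A -> B' \subset B -> m <= #|A'| -> m <= 2 * #|B'| ->
   [/\ A' \subset X, B' \subset X, #|X| <= 4 * c * #|A'| & #|X| <= 4 * c * #|B'| ].
  move=> A'A B'B mA' mB'; split; first [exact: subset_trans A'A AX
    | exact: subset_trans B'B BX | nia].
have mA' : m <= #|A| by lia.
case: AB => /(sparse_of_one_sided m0 mA' mB) [A' [B' [[A'A B'B] dis cA' cB' sp]]];
  have [A'X B'X XA XB] := sub _ _ A'A B'B cA' cB'.
  exists B', A'; rewrite disjoint_sym; split=> //.
  apply: sparse_forward; first by rewrite disjoint_sym.
  by case: sp => sA sB; split.
by exists A', B'; split=> //; apply: sparse_forward.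
Qed.

(** The later sets are found inside the second set [B] of a forward pair. The pair is taken with
    [K * N], since passing to an [N]-th of [B] costs a factor [N]. *)
Lemma forward_chain (H : tournament) K k : 0 < K ->
  exists2 N, 0 < N & forall (T : tournament) (X : {set T}), N <= #|X| ->
  embeds H X \/ exists E : nat -> {set T},
    (forall i, i < k -> E i \subset X /\ #|X| <= N * #|E i|) /\
    (forall i j, i < j -> j < k -> [disjoint E i & E j] /\ forward K (E i) (E j)).
Proof.
move=> K0; elim: k => [|k [N N0 IH]].
  by exists 1 => // T X _; right; exists (fun=> set0).
have KN : 0 < K * N by rewrite muln_gt0 K0.
have [N' pair] := @forward_pair H _ KN.
exists (N'.+1 * N) => [|T X XN]; first by rewrite muln_gt0.
have [|emb|] := pair T X; [by nia|by left|].
move=> [A [B [[AX BX] dis XA XB [fA fB]]]].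
have [|[f [fB' fh]]|[E [E1 E2]]] := IH T B; first nia.
  by left; exists f; split=> // u; apply: (subsetP BX).
right; exists (fun i => if i is i'.+1 then E i' else A); split.
  case=> [|i] ik; first by split=> //; nia.
  have [EB cE] := E1 i ik; split; first exact: subset_trans EB BX.
  by nia.
case=> [|i] [|j] // ij jk; last exact: E2.
have [EB cE] := E1 j jk; split.
  by apply: disjointWr dis; exact: EB.
split=> [a aA|b bE].
  have := fA a aA.
  have : #|[set b in E j | ~~ darc a b]| <= #|[set b in B | ~~ darc a b]|.
    apply/subset_leq_card/subsetP=> b; rewrite !inE => /andP[bE ->].
    by rewrite (subsetP EB b bE).
  by set x := #|_|; set y := #|_|; move=> xy ky; rewrite -(leq_pmul2l N0); nia.
by have := fB b (subsetP EB b bE); nia.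
Qed.

(** * Embedding a flotilla boat by boat *)

Section Flotilla.
Variables (H : tournament) (theta : #|H|.-tuple H).
Hypotheses (theta_uniq : ordering theta)
  (boats : forall x : H, left_boat theta [set y | connect (backedge theta) x y]).
Implicit Types u v x : H.

Local Notation B := (backedge theta).
Local Notation idx u := (index u theta).

Lemma mem_theta u : u \in theta.
Proof.
have [||_ ->] := uniq_min_size theta_uniq (s2 := enum H).
- by move=> x _; rewrite mem_enum.
- by rewrite -cardE size_tuple.
by rewrite mem_enum.
Qed.

Lemma idx_lt u : idx u < #|H|.
Proof. by have := mem_theta u; rewrite -index_mem size_tuple. Qed.

Lemma idx_inj u v : idx u = idx v -> u = v.
Proof.
by move=> E; rewrite -(nth_index u (mem_theta u)) E nth_index ?mem_theta.
Qed.

Lemma idx_tnth i : idx (tnth theta i) = i.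
Proof. by rewrite (tnth_nth (tnth theta i)) index_uniq // size_tuple. Qed.

Lemma backedge_sym : symmetric B.
Proof. by move=> u v; rewrite /backedge /= orbC. Qed.

Lemma connect_csym : connect_sym B.
Proof. exact/sym_connect_sym/backedge_sym. Qed.

Lemma nbackedge_darc u v : idx u < idx v -> ~~ B u v -> darc u v.
Proof.
move=> uv; rewrite /backedge /backward_arc /= uv ltnNge (ltnW uv) andbF andbT /=.
by rewrite -darcN //; apply: contraTneq uv => ->; rewrite ltnn.
Qed.

Lemma backedge_darc u v : idx u < idx v -> B u v -> darc v u.
Proof.
by move=> uv; rewrite /backedge /backward_arc /= uv ltnNge (ltnW uv) andbF andbT.
Qed.

(* The first three vertices of a boat share the position of the first one; the
   last vertex keeps its own position. *)
Definition slot u :=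
  let m := find (connect B u) theta in if idx u <= m + 2 then m else idx u.

Lemma boat_shape x : exists i1 i2 i3 i4 : 'I_#|H|,
  let v := tnth theta in
  [/\ [/\ i1 < i2, i2 < i3, i3 < i4, i2 = i1.+1 :> nat & i3 = i1.+2 :> nat],
      forall y, connect B x y = (y \in [set v i1; v i2; v i3; v i4]),
      [/\ slot (v i1) = i1, slot (v i2) = i1, slot (v i3) = i1 & slot (v i4) = i4],
      [/\ darc (v i1) (v i2), darc (v i2) (v i3) & darc (v i3) (v i1)]
    & [/\ darc (v i4) (v i1), darc (v i4) (v i2) & darc (v i3) (v i4)]].
Proof.
have [i1 [i2 [i3 [i4 /= [[l12 l23 l34] [e2 e3] X [b13 b14 b24] [n12 n23 n34]]]]]] :=
  boats x.
have l13 := ltnW (ltn_trans l12 l23); have l14 := leq_trans l13 (ltnW l34).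
have e2' : i2 = i1.+1 :> nat by move: e2; rewrite e3 addn2 addn1 => -[].
have l12' := ltnW l12.
exists i1, i2, i3, i4 => /=.
have cX y : connect B x y =
    (y \in [set tnth theta i1; tnth theta i2; tnth theta i3; tnth theta i4]).
  by rewrite -X inE.
have lt (i j : 'I_#|H|) : i < j -> idx (tnth theta i) < idx (tnth theta j).
  by rewrite !idx_tnth.
(* [find] returns the least position in the component, which is that of the first vertex of the
   boat. *)
have fnd y : connect B x y -> find (connect B y) theta = i1.
  move=> xy.
  have c1 : connect B y (tnth theta i1).
    rewrite connect_csym in xy; apply: connect_trans xy _.
    by rewrite cX !inE eqxx.
  have hs : has (connect B y) theta.
    by apply/hasP; exists (tnth theta i1) => //; apply: mem_theta.
  have := nth_find (tnth theta i1) hs; set f := find _ _ => cf.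
  have fs : f < #|H| by rewrite -(size_tuple theta) -has_find.
  apply/eqP; rewrite eqn_leq; apply/andP; split.
    rewrite leqNgt; apply/negP=> /(before_find (tnth theta i1)).
    by rewrite -tnth_nth c1.
  have := connect_trans xy cf.
  rewrite -[f in nth _ _ f]/(nat_of_ord (Ordinal fs)) -tnth_nth cX !inE.
  by case/orP=> [/orP[/orP[]|]|] /eqP/(congr1 (fun y => idx y));
    rewrite !idx_tnth /= => ->.
have cv i : (i \in [:: i1; i2; i3; i4]) -> find (connect B (tnth theta i)) theta = i1.
  rewrite !inE => hi; apply: fnd; rewrite cX !inE.
  by case/or4P: hi => /eqP->; rewrite eqxx ?orbT.
split=> //.
- by split=> //; rewrite e3 addn2.
- rewrite /slot !cv ?inE ?eqxx ?orbT // !idx_tnth.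
  split; [by rewrite leq_addr | by rewrite e2' addn2 leqnSn
         | by rewrite -e3 leqnn | by rewrite -e3 leqNgt l34].
- split; first exact: nbackedge_darc (lt _ _ l12) n12.
    exact: nbackedge_darc (lt _ _ l23) n23.
  exact: backedge_darc (lt _ _ (ltn_trans l12 l23)) b13.
split.
- exact: backedge_darc (lt _ _ (ltn_trans (ltn_trans l12 l23) l34)) b14.
- exact: backedge_darc (lt _ _ (ltn_trans l23 l34)) b24.
- exact: nbackedge_darc (lt _ _ l34) n34.
Qed.

Lemma slot_le u : slot u <= idx u.
Proof.
rewrite /slot; case: ifP => // _.
rewrite leqNgt; apply/negP=> /(before_find u).
by rewrite nth_index ?mem_theta // connect0.
Qed.

Lemma slot_lt u : slot u < #|H|.
Proof. exact: leq_ltn_trans (slot_le u) (idx_lt u). Qed.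

(** The first three positions of a boat are consecutive, so a vertex of another boat that precedes
    one of them precedes all three. The arc goes forward because back edges stay inside
    components. *)
Lemma slot_mono u v : ~~ connect B u v -> idx u < idx v ->
  slot u < slot v /\ darc u v.
Proof.
move=> nuv uv; split; last first.
  by apply: nbackedge_darc => //; apply: contra nuv; apply: connect1.
have [i1 [i2 [i3 [i4 [[l12 l23 l34 e2 e3] cX [s1 s2 s3 s4] _ _]]]]] := boat_shape v.
have := connect0 B v; have := connect_csym v u; rewrite (negbTE nuv) !cX !inE.
move/negbT; rewrite !negb_or => /andP[/andP[/andP[n1 n2] n3] _] hv.
have nE i : u != tnth theta i -> idx u != i.
  by apply: contra_neq => E; apply: idx_inj; rewrite idx_tnth.
have := nE _ n1; have := nE _ n2; have := nE _ n3; have := slot_le u.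
by case/orP: hv uv => [/orP[/orP[]|]|] /eqP->; rewrite idx_tnth ?s1 ?s2 ?s3 ?s4; lia.
Qed.

End Flotilla.

Lemma find_boat (T : tournament) (X A D : {set T}) :
  A \subset X -> D \subset X -> [disjoint A & D] ->
  0 < tr X -> 65 <= #|A| ->
  (forall d, d \in D -> 65 * #|outset A d| <= #|A|) ->
  (forall B : {set T}, B \subset A -> #|A| <= 2 * #|B| -> 3 * tr X <= 4 * tr B) ->
  (forall B : {set T}, B \subset D -> #|D| <= 2 * #|B| -> 3 * tr X <= 4 * tr B) ->
  (forall V : {set T}, V \subset A -> V != set0 -> 65 * #|V| <= #|A| ->
     4 * tr X ^ 2 * #|V| <= #|A| * tr V ^ 2) ->
  exists x y z d, [/\ [/\ x \in A, y \in A, z \in A & d \in D],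
    [/\ darc x y, darc y z & darc z x] &
    [/\ darc d x, darc d y & darc z d]].
Proof.
move=> AX DX dis t0 A65 Ds CA CD CV.
pose ok (p : T * T * T * T) := let: (x, y, z, d) := p in
  [&& [&& x \in A, y \in A, z \in A & d \in D],
    [&& darc x y, darc y z & darc z x] &
    [&& darc d x, darc d y & darc z d]].
have [/existsP[[[[x y] z] d] /and3P[/and4P[? ? ? ?] /and3P[? ? ?] /and3P[? ? ?]]]|] :=
  boolP [exists p, ok p].
  by exists x, y, z, d.
rewrite negb_exists => /forallP no; exfalso.
apply: (boat_free_false _ t0 (tr_mono AX) dis Ds A65 CA CD CV); last first.
  by apply: tr_mono; rewrite subUset AX.
move=> d x y z dD xA yA zA xy yz zx dx dy.
have := no (x, y, z, d); rewrite /ok xA yA zA dD xy yz zx dx dy /= -darcN //.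
by apply: contraTneq dy => ->; rewrite (darc_asym yz).
Qed.

Lemma leq_card_bigcup (I T : finType) (U : {set I}) (F : I -> {set T}) :
  #|\bigcup_(i in U) F i| <= \sum_(i in U) #|F i|.
Proof.
elim/big_rec2: _ => [|i A m _ Am]; first by rewrite cards0.
by apply: leq_trans (leq_card_setU _ _) _; rewrite leq_add2l.
Qed.

(** For each new boat, the candidates compatible with all vertices placed so far still fill half of
    each set of the chain, and [find_boat] applies to them. The two conditions on [X] are those that
    a smallest counterexample satisfies. *)
Lemma flotilla_embeds (H : tournament) : left_flotilla H ->
  exists2 N, 0 < N & forall (T : tournament) (X : {set T}), N <= #|X| ->
    (forall Y : {set T}, Y \subset X -> #|X| <= N * #|Y| -> 3 * tr X <= 4 * tr Y) ->
    (forall V A : {set T}, A \subset X -> V \subset A -> V != set0 ->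
       #|X| <= N * #|A| -> 65 * #|V| <= #|A| ->
       4 * tr X ^ 2 * #|V| <= #|A| * tr V ^ 2) ->
    embeds H X.
Proof.
(* The term [2 * h] leaves half of a set after at most [h] placed vertices; 130 = 2 * 65 gives the
   factor 65 inside that half. *)
move=> [theta [theta_uniq boats]]; pose h := #|H|; pose K := 2 * h + 130.
have [|N N0 chain] := @forward_chain H K h; first by rewrite /K addn_gt0 orbT.
(* The factor 130 leaves at least 65 vertices in half of a set of the chain; it also covers the loss
   of a factor 4 by halving twice. *)
exists (N * 130) => [|T X XN C1 C2]; first by rewrite muln_gt0 N0.
have X0 : 0 < #|X| by apply: leq_trans XN; rewrite muln_gt0 N0.
have [x0 x0X] : exists x, x \in X by apply/card_gt0P.
pose ro := slot theta; pose E0 := connect (backedge theta).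
have smono : forall u v, ~~ E0 u v -> index u theta < index v theta ->
  ro u < ro v /\ darc u v := slot_mono theta_uniq boats.
have csym : connect_sym (backedge theta) := connect_csym theta.
have [|emb|[E [E1 E2]]] := chain T X; [by nia|exact: emb|].
pose homU (U : {set H}) (f : H -> T) :=
  [/\ forall u v, u \in U -> E0 u v -> v \in U,
      forall u, u \in U -> f u \in E (ro u)
    & forall u v, u \in U -> v \in U -> darc u v -> darc (f u) (f v)].
(* A step adds a whole boat, hence at least one vertex. *)
suff build n : n <= h -> exists (U : {set H}) f, n <= #|U| /\ homU U f.
  have [U [f [hU [_ fE fhom]]]] := build h (leqnn h).
  have UT u : u \in U.
    have /eqP -> : U == setT by rewrite eqEcard subsetT cardsT.
    by rewrite inE.
  exists f; split=> [u|u v]; last exact: fhom.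
  by have [/subsetP EX _] := E1 _ (slot_lt theta_uniq u); apply/EX/fE.
elim: n => [|n IH] nh.
  by exists set0, (fun=> x0); split=> //; split=> [u v|u|u v]; rewrite inE.
have [U [f [nU [closed fE fhom]]]] := IH (ltnW nh).
have [|ltU] := leqP h #|U|.
  by move=> hU; exists U, f; split=> //; apply: leq_trans hU.
have /subsetPn[x _ xU] : ~~ (setT \subset U).
  by apply: contraL ltU => /subset_leq_card; rewrite cardsT -leqNgt.
have [i1 [i2 [i3 [i4 [[l12 l23 l34 _ _] cX [s1 s2 s3 s4]]]]]] :=
  boat_shape theta_uniq boats x.
have := idx_tnth theta_uniq i4; have := idx_tnth theta_uniq i3.
have := idx_tnth theta_uniq i2; have := idx_tnth theta_uniq i1.
move: s1 s2 s3 s4 cX; set a := tnth _ i1; set b := tnth _ i2.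
set c := tnth _ i3; set d := tnth _ i4; rewrite -/ro -/E0.
move=> s1 s2 s3 s4 cX ia ib ic id [ab bc ca] [da db cd].
set C := [set a; b; c; d] in cX.
have nconn u w : u \in U -> w \in C -> ~~ E0 u w.
  move=> uU wC; apply: contra xU => uw; apply: (closed u) => //.
  by apply: connect_trans uw _; rewrite csym [connect _ _ _]cX.
have nconn' u w : u \in U -> w \in C -> ~~ E0 w u.
  by move=> uU wC; rewrite /E0 csym nconn.
have nUC u w : u \in U -> w \in C -> u != w.
  by move=> uU wC; apply: contraNneq (nconn u w uU wC) => ->; apply: connect0.
(* Arcs between distinct boats go from the lower slot to the higher one, and these slots differ, so
   placed and new vertices belong to different sets of the chain. *)
have ltUC u w : u \in U -> w \in C -> darc u w -> ro u < ro w.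
  move=> uU wC uw; case: (ltngtP (index u theta) (index w theta)) => [h1|h1|h1].
  - by have [] := smono u w (nconn u w uU wC) h1.
  - have [_] := smono w u (nconn' u w uU wC) h1.
    by rewrite (darc_asym uw).
  - by move: (nUC u w uU wC); rewrite (idx_inj theta_uniq h1) eqxx.
have ltCU u w : u \in U -> w \in C -> darc w u -> ro w < ro u.
  move=> uU wC wu; case: (ltngtP (index u theta) (index w theta)) => [h1|h1|h1].
  - have [_] := smono u w (nconn u w uU wC) h1.
    by rewrite (darc_asym wu).
  - by have [] := smono w u (nconn' u w uU wC) h1.
  - by move: (nUC u w uU wC); rewrite (idx_inj theta_uniq h1) eqxx.
have neUC u w : u \in U -> w \in C -> ro u != ro w.
  move=> uU wC; have := darc_tot (nUC u w uU wC).
  case uw : (darc u w); first by rewrite ltn_eqF ?ltUC.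
  by move=> wu; rewrite gtn_eqF ?ltCU.
pose bad p u := [set y in E p |
  ~~ (if ro u < p then darc (f u) y else darc y (f u))].
pose cand p := [set y in E p |
  [forall u in U, if ro u < p then darc (f u) y else darc y (f u)]].
have candE p : cand p \subset E p.
  by apply/subsetP=> y; rewrite inE => /andP[].
have cand_big w : w \in C -> #|E (ro w)| <= 2 * #|cand (ro w)|.
  move=> wC; set p := ro w; have ph : p < h := slot_lt theta_uniq w.
  have badK u : u \in U -> K * #|bad p u| <= #|E p|.
    move=> uU; have uh : ro u < h := slot_lt theta_uniq u.
    rewrite /bad; case: ltngtP => [up|pu|E'].
    - by have [_ [fw _]] := E2 _ _ up ph; apply: fw; apply: fE.
    - by have [_ [_ fw]] := E2 _ _ pu uh; apply: fw; apply: fE.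
    - by move: (neUC u w uU wC); rewrite E' eqxx.
  have cov : E p :\: cand p \subset \bigcup_(u in U) bad p u.
    apply/subsetP=> y; rewrite !inE => /andP[+ yE]; rewrite yE /=.
    rewrite negb_forall => /existsP[u]; rewrite negb_imply => /andP[uU nu].
    by apply/bigcupP; exists u => //; rewrite inE yE.
  have l1 : K * #|E p :\: cand p| <= #|U| * #|E p|.
    rewrite -sum_nat_const; apply: (@leq_trans (\sum_(u in U) K * #|bad p u|)).
      rewrite -big_distrr leq_mul2l; apply/orP; right.
      exact: leq_trans (subset_leq_card cov) (leq_card_bigcup _ _).
    exact: leq_sum.
  have l2 : 2 * h * #|E p :\: cand p| <= h * #|E p|.
    apply: (@leq_trans (K * #|E p :\: cand p|)).
      by rewrite leq_mul2r leq_addr orbT.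
    by apply: leq_trans l1 _; rewrite leq_mul2r (ltnW ltU) orbT.
  have h0 : 0 < h by apply: leq_ltn_trans ltU.
  have l3 : 2 * #|E p :\: cand p| <= #|E p|.
    by rewrite -(leq_pmul2l h0) mulnA (mulnC h).
  have := cardsID (cand p) (E p); rewrite (setIidPr (candE p)).
  by move: l3; clear; lia.
have [aC bC cC dC] : [/\ a \in C, b \in C, c \in C & d \in C].
  by rewrite !inE !eqxx !orbT.
have := cand_big a aC; have := cand_big d dC; rewrite s1 s4 => big4 big1.
have i14 : i1 < i4 := ltn_trans (ltn_trans l12 l23) l34.
have [EX1 cE1] := E1 i1 (ltn_ord i1); have [EX4 cE4] := E1 i4 (ltn_ord i4).
have [dis [_ fw]] := E2 i1 i4 i14 (ltn_ord i4).
have large e g : #|X| <= N * e -> e <= 130 * g -> #|X| <= N * 130 * g.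
  by move=> Xe eb; apply: leq_trans Xe _; rewrite -mulnA leq_mul2l eb orbT.
have [|||||||||y1 [y2 [y3 [y4 [[m1 m2 m3 m4] [y12 y23 y31] [y41 y42 y34]]]]]] :=
  @find_boat T X (cand i1) (cand i4).
- exact: subset_trans (candE _) EX1.
- exact: subset_trans (candE _) EX4.
- exact: disjointW (candE _) (candE _) dis.
- exact: leq_card_tr.
- have : 130 <= #|E i1| by rewrite -(leq_pmul2l N0) (leq_trans XN).
  by move: big1; clear; lia.
- move=> y /(subsetP (candE _)) yE; have := fw y yE.
  have : #|outset (cand i1) y| <= #|[set z in E i1 | ~~ darc z y]|.
    apply/subset_leq_card/subsetP=> z; rewrite [z \in outset _ _]inE => /andP[/(subsetP (candE _)) zE yz].
    by rewrite inE zE (darc_asym yz).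
  rewrite /K; set u := #|outset _ _|; set v := #|[set _ in _ | _]|.
  by move: big1; clear; nia.
- move=> B BA cB; apply: C1; last by apply: large cE1 _; move: big1 cB; clear; lia.
  exact: subset_trans BA (subset_trans (candE _) EX1).
- move=> B BA cB; apply: C1; last by apply: large cE4 _; move: big4 cB; clear; lia.
  exact: subset_trans BA (subset_trans (candE _) EX4).
- move=> V VA V0 cV; apply: C2 => //; last by apply: large cE1 _; move: big1; clear; lia.
  exact: subset_trans (candE _) EX1.
pose f' u := if u == a then y1 else if u == b then y2 else
  if u == c then y3 else if u == d then y4 else f u.
have neq u v : index u theta < index v theta -> (u == v = false) * (v == u = false).
  by move=> uv; split; apply: contraTF uv => /eqP->; rewrite ltnn.
have [ab' bc' cd'] : [/\ index a theta < index b theta,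
    index b theta < index c theta & index c theta < index d theta].
  by rewrite ia ib ic id.
have f'a : f' a = y1 by rewrite /f' eqxx.
have f'b : f' b = y2 by rewrite /f' eqxx (neq a b).
have f'c : f' c = y3.
  by rewrite /f' eqxx !(neq b c) // !(neq a c) // (ltn_trans ab').
have f'd : f' d = y4.
  rewrite /f' eqxx !(neq c d) // !(neq b d) ?(ltn_trans bc') //.
  by rewrite !(neq a d) // (ltn_trans ab') // (ltn_trans bc').
have f'U u : u \in U -> f' u = f u.
  by move=> uU; rewrite /f' !ifN // nUC.
have f'C w : w \in C -> f' w \in cand (ro w).
  rewrite !inE => /orP[/orP[/orP[]|]|] /eqP->;
    rewrite ?f'a ?f'b ?f'c ?f'd ?s1 ?s2 ?s3 ?s4.
  - by move: m1; rewrite inE.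
  - by move: m2; rewrite inE.
  - by move: m3; rewrite inE.
  - by move: m4; rewrite inE.
exists (U :|: C), f'; split.
  apply: leq_ltn_trans nU _; apply: proper_card; apply/properP.
  split; first exact: subsetUl.
  by exists a; rewrite ?inE ?eqxx ?orbT //; apply: contraTN aC => aU;
    apply/negP=> aC; move: (nUC a a aU aC); rewrite eqxx.
split.
- move=> u v; rewrite ![_ \in U :|: C]in_setU => /orP[uU|uC] uv; first by rewrite (closed u v).
  apply/orP; right; rewrite -cX; apply: connect_trans uv.
  by rewrite [connect _ _ _]cX.
- move=> u; rewrite [u \in _]in_setU => /orP[uU|uC]; first by rewrite f'U ?fE.
  exact: subsetP (candE _) _ (f'C u uC).
move=> u v; rewrite ![_ \in U :|: C]in_setU => /orP[uU|uC] /orP[vU|vC] uv.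
- by rewrite !f'U // fhom.
- have := f'C v vC; rewrite inE => /andP[_ /forall_inP/(_ u uU)].
  by rewrite ltUC // (f'U u).
- have := f'C u uC; rewrite inE => /andP[_ /forall_inP/(_ v vU)].
  by rewrite ltnNge (ltnW (ltCU v u vU uC uv)) /= (f'U v).
move: uC vC uv; rewrite !inE.
move=> /orP[/orP[/orP[]|]|] /eqP-> /orP[/orP[/orP[]|]|] /eqP->;
  rewrite ?f'a ?f'b ?f'c ?f'd ?darc_irr ?(darc_asym ab) ?(darc_asym bc)
    ?(darc_asym ca) ?(darc_asym da) ?(darc_asym db) ?(darc_asym cd) //.
Qed.

(** * The exponent *)

(** Without cyclic triangles the arc relation is transitive, so a directed cycle through [x] would
    give an arc from [x] to itself. *)
Lemma transitive_on_induced (T : tournament) (S : {set T}) :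
  transitive_on S -> transitive_tournament (induced S).
Proof.
move=> /transitive_onP tS [[|x p] [// _ /andP[]]] /= + _.
have tr_arc : transitive (@induced_arc T S).
  move=> y x' z; rewrite /induced_arc /= => xy yz.
  have nzx : ~~ darc (val z) (val x').
    by apply/negP; apply: (tS (val x') (val y) (val z)); rewrite ?(valP x') ?(valP y) ?(valP z).
  rewrite darcN //; apply: contraTneq xy => ->.
  by rewrite (darc_asym yz).
move=> /(order_path_min tr_arc)/allP/(_ x).
by rewrite mem_rcons mem_head induced_arc_irr => /(_ isT).
Qed.

Local Open Scope ring_scope.

Section Exponent.
Variables (R : realType) (N : nat).
Hypothesis N0 : (0 < N)%N.
(** Bernoulli's inequality bounds the power [4 * N] of 4/3 below by [N], so [N] to the power [eps]
    is at most 4/3: an [N]-th of the vertices keeps three quarters of the bound. Also [eps] is at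
    most 1/4, as the ratio estimate requires. *)
Let eps : R := (4 * N)%:R^-1.

Lemma bernoulli_nat (k : nat) : 1 + k%:R / 3 <= (4 / 3 : R) ^+ k.
Proof.
elim: k => [|k IH]; first by rewrite expr0 mul0r addr0.
rewrite exprS -natr1; have : 0 <= k%:R :> R by apply: ler0n.
by move: IH; set x := _ ^+ k; nra.
Qed.

Lemma exponent_gt0 : 0 < eps.
Proof. by rewrite invr_gt0 ltr0n muln_gt0. Qed.

Lemma exponent_le : eps <= 4^-1.
Proof. by rewrite lef_pV2 ?posrE ?ltr0n ?muln_gt0 // ler_nat leq_pmulr. Qed.

Lemma powR_exponent_le : (N%:R : R) `^ eps <= 4 / 3.
Proof.
have -> : (4 / 3 : R) = ((4 / 3) ^+ (4 * N)) `^ eps.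
  rewrite -powR_mulrn; last by lra.
  by rewrite -powRrM mulfV ?powRr1 ?pnatr_eq0 -?lt0n ?muln_gt0 //; lra.
apply: ge0_ler_powR; rewrite ?nnegrE ?ler0n ?(ltW exponent_gt0) //.
  by apply: exprn_ge0; lra.
apply: le_trans (bernoulli_nat (4 * N)).
by rewrite natrM; have := ler0n R N; lra.
Qed.

Lemma powR_le_scaled (n y : nat) : (n <= N * y)%N ->
  (n%:R : R) `^ eps <= 4 / 3 * y%:R `^ eps.
Proof.
move=> ny; apply: (@le_trans _ _ ((N * y)%:R `^ eps)).
  by apply: ge0_ler_powR; rewrite ?nnegrE ?ler0n ?ler_nat ?(ltW exponent_gt0).
by rewrite natrM powRM ?ler0n // ler_wpM2r ?powR_ge0 // powR_exponent_le.
Qed.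

(* With y = a / v >= 64 and s = y^(1/4), this rests on
   (t / w)^2 <= (16/9) y^(2 eps) <= 2 s^2 <= s^4 / 4. *)
Lemma powR_small_ratio (n a v t w : nat) : (0 < v)%N -> (n <= N * a)%N ->
  (65 * v <= a)%N -> t%:R <= (n%:R : R) `^ eps -> (v%:R : R) `^ eps <= w%:R ->
  (4 * t ^ 2 * v <= a * w ^ 2)%N.
Proof.
move=> v0 na va tn vw.
have v0' : 0 < v%:R :> R by rewrite ltr0n.
pose y : R := a%:R / v%:R.
have y64 : 64 <= y.
  by rewrite /y ler_pdivlMr // -natrM ler_nat (leq_trans _ va) // leq_mul2r orbT.
have ay : a%:R = y * v%:R by rewrite /y divfK // gt_eqF.
pose s := y `^ 4^-1.
have s0 : 0 <= s by apply: powR_ge0.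
have s4 : s ^+ 4 = y.
  by rewrite -powR_mulrn // -powRrM mulVf ?pnatr_eq0 // powRr1 //; lra.
have s2 : 8 <= s ^+ 2.
  by have : 0 <= s ^+ 2 by [apply: sqr_ge0]; move: s4 y64; rewrite -[4%N]/(2 * 2)%N exprM; nra.
have ts : t%:R <= 4 / 3 * (s * w%:R).
  apply: le_trans tn _; apply: le_trans (powR_le_scaled na) _.
  rewrite ler_wpM2l //; first by lra.
  rewrite ay powRM ?(ltW v0') //; last by lra.
  by rewrite ler_pM ?powR_ge0 // ler_powR ?exponent_le //; lra.
have tsq : t%:R ^+ 2 <= 16 / 9 * (s ^+ 2 * w%:R ^+ 2).
  have : 0 <= t%:R :> R by apply: ler0n.
  by move: ts; set u := s * _ => ts t0; rewrite -exprMn -/u; nra.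
rewrite -(ler_nat R) !(natrX, natrM) ay -s4.
suff : 4 * t%:R ^+ 2 <= s ^+ 4 * w%:R ^+ 2 by move=> h; nra.
apply: (@le_trans _ _ (8 * (s ^+ 2 * w%:R ^+ 2))).
  have : 0 <= s ^+ 2 * w%:R ^+ 2 by rewrite mulr_ge0 ?sqr_ge0.
  by move: tsq; lra.
rewrite mulrA ler_wpM2r ?sqr_ge0 // -[4%N]/(2 + 2)%N exprD.
by rewrite ler_wpM2r ?sqr_ge0.
Qed.

Lemma powR_lt2 (n : nat) : (n <= N)%N -> (n%:R : R) `^ eps < 2.
Proof.
move=> nN; have : (n%:R : R) `^ eps <= 4 / 3 * 1%:R `^ eps.
  by apply: powR_le_scaled; rewrite muln1.
by rewrite powR1; lra.
Qed.

End Exponent.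

Theorem theorem3 (R : realType) (H : tournament) (hH : left_flotilla H) :
  exists eps : R, 0 < eps /\
    forall T : tournament, H_free H T ->
      exists S : {set T},
        transitive_tournament (induced S) /\
        (#|T|%:R : R) `^ eps <= #|S|%:R.
Proof.
have [N N0 emb] := flotilla_embeds hH.
exists (4 * N)%:R^-1; split; first exact: exponent_gt0.
move=> T free; set eps := _^-1.
(* Stated for all vertex sets, so that strong induction makes [X] a smallest counterexample. *)
suff large (X : {set T}) : (#|X|%:R : R) `^ eps <= (tr X)%:R.
  have [S [_ tS eS]] := tr_witness [set: T].
  exists S; split; first exact: transitive_on_induced.
  by rewrite eS -cardsT large.
have [n] := ubnP #|X|; elim: n X => // n IH X Xn.
rewrite leNgt; apply/negP => trX.
have IHX (Y : {set T}) : (#|Y| < #|X|)%N -> (#|Y|%:R : R) `^ eps <= (tr Y)%:R.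
  by move=> YX; apply: IH; apply: leq_trans YX _.
apply: free; apply: (@embeds_contains _ _ X); apply: emb.
(* If [X] had fewer than [N] vertices, then [tr X] would be below 2, so [X] would have at most one
   vertex, where the bound holds. *)
- rewrite leqNgt; apply/negP=> /ltnW/(powR_lt2 R N0) lt2.
  have trX2 : (tr X < 2)%N by rewrite -(ltr_nat R); apply: lt_trans lt2.
  have X2 : (#|X| < 2)%N by rewrite ltnNge; apply/negP=> /leq_card_tr; lia.
  move: trX; case cX : #|X| X2 => [|[|//]] _.
    by rewrite powR0 ?gt_eqF ?exponent_gt0 // ltNge ler0n.
  by rewrite powR1 ltNge ler1n leq_card_tr // cX.
(* [Y] may be all of [X], where induction gives nothing but the inequality is immediate. *)
- move=> Y YX XY; have [lt|ge] := ltnP #|Y| #|X|; last first.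
    have /eqP -> : Y == X by rewrite eqEcard YX.
    by rewrite leq_mul2r orbT.
  rewrite -(ler_nat R) !natrM.
  have := powR_le_scaled R N0 XY; rewrite -/eps.
  by move: (IHX Y lt) trX; lra.
- move=> V A AX VA V0 XA VA65.
  have v0 : (0 < #|V|)%N by rewrite card_gt0.
  apply: (powR_small_ratio N0 v0 XA VA65 (ltW trX)).
  apply: IHX; apply: leq_trans (subset_leq_card AX).
  by apply: leq_trans VA65; rewrite ltn_Pmull.
Qed.
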